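(* Let $\eta,\theta\in\mathbb{R}$, $\tau\ge0$, $|q|<1$, let $\widetilde\theta:=\theta+\frac{\eta\tau}{1-q}$, and assume $$1+\eta\widetilde\theta\ge\max\{0,q\}.$$ Consider the bi-Poisson process $QH(\eta,\widetilde\theta;0,0;q)$ with transition probabilities $\mathsf{Q}_{s,t}(x,\mathrm{d}y)$, $0\le s<t$. Then for all $t>0$ and $x\in\mathbb{R}$ $$\nu_{x,t,\eta,\theta,\tau,q}(\mathrm{d}y)=\mathsf{Q}_{\frac{q^2\alpha_t}{1-q},\,\frac{\alpha_t}{1-q}}\big(qx+\gamma_t+\beta_t,\mathrm{d}y\big),$$ where $\alpha_t:=\tau+(1-q)t$, $\beta_t:=\eta\alpha_t$, $\gamma_t:=\theta-\eta t$.
   Context: Notation: $[n]_q=1+q+\dots+q^{n-1}$ for $n\ge1$, $[0]_q=0$. An orthogonality measure of a sequence of polynomials $(p_n)$ is a probability measure $\mu$ on $\mathbb{R}$ with $\int p_np_m\,\mathrm{d}\mu=0$ for $n\ne m$. For $|q|<1$ the recurrences below have coefficients bounded in $n$, so orthogonality measures are unique when they exist. $\nu_{x,t,\eta,\theta,\tau,q}$ is the probability orthogonality measure of the polynomials $B_n(y;x,t)$ in $y$ given by $B_{-1}=0$, $B_0=1$ and for $n\ge0$ $$\begin{aligned}y B_n(y;x,t)=\;&B_{n+1}(y;x,t)+\big((\gamma_t+\beta_t([n+1]_q+[n]_q))[n+1]_q+x q^{n+1}\big)B_n(y;x,t)\\&+\alpha_t\big(1+\eta\gamma_t[n]_q+\eta\beta_t[n]_q^2+x\eta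 q^{n}\big)[n+1]_q[n]_q\, B_{n-1}(y;x,t).\end{aligned}$$ The bi-Poisson process $QH(\eta,\widetilde\theta;0,0;q)$ is the Markov process (known to exist under $1+\eta\widetilde\theta\ge\max\{0,q\}$) whose transition probabilities are constructed as follows: $\mathsf{Q}_{s,t}(x,\mathrm{d}y)$, $0\le s<t$, is the unique probability orthogonality measure of the polynomials $Q_n(y;x,t,s)$ in $y$ given by $Q_{-1}=0$, $Q_0=1$, $$yQ_n(y;x,t,s)=Q_{n+1}(y;x,t,s)+\mathcal{A}_n(x,t,s)Q_n(y;x,t,s)+\mathcal{B}_n(x,t,s)Q_{n-1}(y;x,t,s),\quad n\ge0,$$ with $\mathcal{A}_0=x$, $\mathcal{B}_0=0$ and for $n\ge1$ $$\mathcal{A}_n(x,t,s)=q^nx+[n]_q\big(\eta t+\widetilde\theta-\eta s(1+q)q^{n-1}\big),$$ $$\mathcal{B}_n(x,t,s)=[n]_q(t-sq^{n-1})\big\{1+\eta xq^{n-1}+\eta[n-1]_q(\widetilde\theta-\eta sq^{n-1})\big\}.$$ It is defined for those $x$ for which $\prod_{k=1}^n\mathcal{B}_k(x,t,s)\ge0$ for all $n\ge1$, i.e. exactly when a probability orthogonality measure exists. The equality in the claim is read as: either side exists whenever the other does, and then they are equal. *)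

(* Defs.v *)
From HB Require Import structures.
From mathcomp Require Import all_boot all_order all_algebra.
From mathcomp Require Import all_classical all_reals all_analysis.
Set Implicit Arguments.
Unset Strict Implicit.
Unset Printing Implicit Defensive.
Import Order.TTheory GRing.Theory Num.Theory.
Import numFieldNormedType.Exports.
Local Open Scope ring_scope.

Definition qnum (R : realType) (q : R) (n : nat) : R := \sum_(i < n) q ^+ i.

(* p_(-1) = 0, p_0 = 1 and 'X * p_n = p_(n+1) + a_n p_n + b_n p_(n-1);
   the value b 0 is irrelevant. *)
Fixpoint monic_ops (R : realType) (a b : nat -> R) (n : nat) : {poly R} :=
  if n is n1.+1 then
    ('X - (a n1)%:P) * monic_ops a b n1
    - (if n1 is n2.+1 then b n1 *: monic_ops a b n2 else 0)
  else 1.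

(* Since p 0 = 1 below, the integrability clause says in particular that every
   p n is integrable, so that all moments are finite; it is needed because the
   integral is a total function. *)
Definition orthogonality_measure (R : realType) (p : nat -> {poly R})
    (mu : probability (measurableTypeR R) R) : Prop :=
  forall n m : nat, n != m ->
    mu.-integrable [set: R] (fun y => ((p n).[y] * (p m).[y])%:E) /\
    (\int[mu]_y ((p n).[y] * (p m).[y])%:E = 0)%E.

Definition alpha_ (R : realType) (tau q t : R) : R := tau + (1 - q) * t.
Definition beta_ (R : realType) (eta tau q t : R) : R := eta * alpha_ tau q t.
Definition gamma_ (R : realType) (eta theta t : R) : R := theta - eta * t.

Definition B_diag (R : realType) (x t eta theta tau q : R) (n : nat) : R :=
  (gamma_ eta theta t
   + beta_ eta tau q t * (qnum q n.+1 + qnum q n)) * qnum q n.+1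
  + x * q ^+ n.+1.

Definition B_sub (R : realType) (x t eta theta tau q : R) (n : nat) : R :=
  alpha_ tau q t
  * (1 + eta * gamma_ eta theta t * qnum q n
     + eta * beta_ eta tau q t * qnum q n ^+ 2 + x * eta * q ^+ n)
  * qnum q n.+1 * qnum q n.

Definition B_poly (R : realType) (x t eta theta tau q : R) : nat -> {poly R} :=
  monic_ops (B_diag x t eta theta tau q) (B_sub x t eta theta tau q).

Definition is_nu (R : realType) (x t eta theta tau q : R)
    (mu : probability (measurableTypeR R) R) : Prop :=
  orthogonality_measure (B_poly x t eta theta tau q) mu.

(* In both coefficients the case n = m.+1 is written with n-1 = m. *)
Definition Q_diag (R : realType) (eta thetat q s t x : R) (n : nat) : R :=
  if n is m.+1 then
    q ^+ n * x + qnum q n * (eta * t + thetat - eta * s * (1 + q) * q ^+ m)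
  else x.

Definition Q_sub (R : realType) (eta thetat q s t x : R) (n : nat) : R :=
  if n is m.+1 then
    qnum q n * (t - s * q ^+ m)
    * (1 + eta * x * q ^+ m + eta * qnum q m * (thetat - eta * s * q ^+ m))
  else 0.

Definition Q_poly (R : realType) (eta thetat q s t x : R) : nat -> {poly R} :=
  monic_ops (Q_diag eta thetat q s t x) (Q_sub eta thetat q s t x).

(* mu is the transition probability from x, between the times s and t, of the
   process QH(eta, thetat; 0, 0; q). The first two clauses are the conditions
   under which the transition probability is defined. *)
Definition bi_poisson_transition (R : realType) (eta thetat q s t x : R)
    (mu : probability (measurableTypeR R) R) : Prop :=
  [/\ 0 <= s < t,
      forall n : nat, (0 < n)%N ->
        0 <= \prod_(1 <= k < n.+1) Q_sub eta thetat q s t x k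
    & orthogonality_measure (Q_poly eta thetat q s t x) mu].

(* Main.v *)
Require Import Defs.
From mathcomp Require Import all_boot all_order all_algebra.
From mathcomp Require Import all_classical all_reals all_analysis.
From mathcomp Require Import ring lra measurable_realfun.
Import Order.TTheory GRing.Theory Num.Theory.
Import numFieldNormedType.Exports.
Local Open Scope ring_scope.

(** With s = q^2 alpha_t / (1-q), t' = alpha_t / (1-q) and starting point
    qx + gamma_t + beta_t, the recurrence coefficients of the polynomials Q_n are
    exactly those of the polynomials B_n: after writing [n]_q = (1-q^n)/(1-q)
    this is an identity of rational functions of q and q^n ([Q_diagE],
    [Q_subE]).  The two families of polynomials are therefore equal, and the
    two sides of the claim are orthogonality measures of one and the same
    sequence.

    Two analytic points remain.  A transition probability is only defined where
    the products B_1 ... B_n are nonnegative; this is automatic as soon as an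
    orthogonality measure exists, because the product is the integral of the
    square of the n-th polynomial ([poly_mean_sqr]).

    The other point is uniqueness of the measure
    ([orthogonality_measure_unique]).  The three-term recurrence for p_k gives
    a recurrence for the numbers E[y^m p_k(y)], which determines them
    ([poly_mean_mixed]), hence determines all moments; when the coefficients
    are bounded it also bounds the m-th moment by C^m
    ([mixed_moment_bounded]).  Such growth confines the measure to the interval
    from -2C to 2C ([moment_bound_support]).  On a bounded interval the
    indicator of a half-line is a bounded pointwise limit of explicit
    polynomials ([step_poly_cvg]), so by dominated convergence the mass of each
    half-line is a limit of quantities that depend on the moments only
    ([moment_determinate]), and half-lines determine a probability measure. *)

(** * The two recurrences coincide *)

Lemma qnum_closed (R : realType) (q : R) (n : nat) : q != 1 ->
  qnum q n = (1 - q ^+ n) / (1 - q).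
Proof.
move=> q1; rewrite /qnum -[1 - q ^+ n]opprB subrX1 -mulNr opprB mulrAC.
by rewrite divff ?mul1r// subr_eq0 eq_sym.
Qed.

Lemma eq_monic_ops (R : realType) (a a' b b' : nat -> R) :
  a =1 a' -> (forall n, b n.+1 = b' n.+1) ->
  monic_ops a b = monic_ops a' b'.
Proof.
move=> eqa eqb; apply: funext => n.
suff [] : monic_ops a b n = monic_ops a' b' n /\
          monic_ops a b n.+1 = monic_ops a' b' n.+1 by [].
(* The recursion goes back two steps, so two consecutive values are carried. *)
elim: n => [|n [IH IH1]]; first by rewrite /= eqa.
split=> //; change (('X - (a n.+1)%:P) * monic_ops a b n.+1
  - b n.+1 *: monic_ops a b n = ('X - (a' n.+1)%:P) * monic_ops a' b' n.+1
  - b' n.+1 *: monic_ops a' b' n).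
by rewrite eqa eqb IH IH1.
Qed.

Section coefficients.
Variables (R : realType) (x t eta theta tau q thetat : R).
Hypothesis q_neq1 : q != 1.
Hypothesis thetatE : thetat = theta + eta * tau / (1 - q).
Local Notation al := (alpha_ tau q t).
Local Notation x' := (q * x + gamma_ eta theta t + beta_ eta tau q t).

Lemma Q_diagE (n : nat) :
  Q_diag eta thetat q (q ^+ 2 * al / (1 - q)) (al / (1 - q)) x' n =
  B_diag x t eta theta tau q n.
Proof.
have q1 : 1 - q != 0 by rewrite subr_eq0 eq_sym.
rewrite /B_diag /beta_ /gamma_ /alpha_ thetatE.
case: n => [|m] /=; rewrite !qnum_closed// ?exprS ?expr0; field; exact: q1.
Qed.

Lemma Q_subE (n : nat) :
  Q_sub eta thetat q (q ^+ 2 * al / (1 - q)) (al / (1 - q)) x' n =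
  B_sub x t eta theta tau q n.
Proof.
have q1 : 1 - q != 0 by rewrite subr_eq0 eq_sym.
rewrite /B_sub /beta_ /gamma_ /alpha_ thetatE.
case: n => [|m] /=; first by rewrite [qnum q 0]big_ord0 mulr0.
rewrite !qnum_closed// ?exprS ?expr0; field; exact: q1.
Qed.

End coefficients.

Section bounded_coefficients.
Variables (R : realType) (q : R).
Hypothesis q_lt1 : `|q| < 1.

(* All coefficients are polynomial expressions in the convergent sequences q^n
   and [n]_q; convergence is stable under these operations and implies
   boundedness. *)
Let cst_cvg (c : R) : cvgn (fun=> c). Proof. exact: is_cvg_cst. Qed.

Let shift_cvg (u : R^nat) : cvgn u -> cvgn (fun n => u n.+1).
Proof. by move=> /cvg_ex[l ul]; apply/cvg_ex; exists l; rewrite cvg_shiftS. Qed.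

Let expr_cvg : cvgn (fun n => q ^+ n).
Proof. by apply/cvg_ex; exists 0; exact: cvg_expr. Qed.

Let qnum_cvg : cvgn (qnum q).
Proof.
have q1 : q != 1 by apply: contraTneq q_lt1 => ->; rewrite normr1 ltxx.
rewrite (_ : qnum q = fun n => (1 - q ^+ n) / (1 - q)); last first.
  by apply: funext => n; exact: qnum_closed.
by apply: is_cvgM => //; exact: is_cvgB.
Qed.

Let cvg_bounded (u : R^nat) : cvgn u -> exists M, forall n, `|u n| <= M.
Proof.
move=> /cvg_seq_bounded[M [_ HM]]; exists (M + 1) => n.
by apply: HM; rewrite ?ltrDl.
Qed.

Lemma B_diag_bounded x t eta theta tau :
  exists M, forall n, `|B_diag x t eta theta tau q n| <= M.
Proof.
apply: cvg_bounded; rewrite /B_diag.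
have e1 := shift_cvg _ expr_cvg; have n1 := shift_cvg _ qnum_cvg.
apply: is_cvgD; last exact: is_cvgM.
apply: is_cvgM => //; apply: is_cvgD => //.
by apply: is_cvgM => //; exact: is_cvgD.
Qed.

Lemma B_sub_bounded x t eta theta tau :
  exists M, forall n, `|B_sub x t eta theta tau q n| <= M.
Proof.
apply: cvg_bounded; rewrite /B_sub.
have n1 := shift_cvg _ qnum_cvg.
apply: is_cvgM => //; apply: is_cvgM => //; apply: is_cvgM => //.
apply: is_cvgD; last exact: is_cvgM.
apply: is_cvgD; last by apply: is_cvgM => //; exact: is_cvgM.
by apply: is_cvgD => //; exact: is_cvgM.
Qed.

End bounded_coefficients.

(** * Moments of an orthogonality measure *)

(** The value forced on E[y^m p_k(y)] by the orthogonality of p_k to constants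
    (m = 0) and by the expansion of y p_k in terms of p_(k+1), p_k and
    p_(k-1). *)
Fixpoint mixed_moment {R : realType} (a b : nat -> R) (m k : nat) : R :=
  if m is m1.+1 then
    mixed_moment a b m1 k.+1 + a k * mixed_moment a b m1 k
    + (if k is k1.+1 then b k * mixed_moment a b m1 k1 else 0)
  else (k == 0)%:R.

(** One step of the recurrence in m multiplies a bound that is uniform in k by
    at most C = 1 + sup |a| + sup |b|. *)
Lemma mixed_moment_bounded {R : realType} (a b : nat -> R) :
  (exists M, forall n, `|a n| <= M) -> (exists M, forall n, `|b n| <= M) ->
  exists2 C : R, 0 < C & forall m k, `|mixed_moment a b m k| <= C ^+ m.
Proof.
move=> [A HA] [B HB].
have A0 : 0 <= A := le_trans (normr_ge0 _) (HA 0).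
have B0 : 0 <= B := le_trans (normr_ge0 _) (HB 0).
have C0 : 0 < 1 + A + B by lra.
exists (1 + A + B) => //; elim=> [|m IH] k /=.
  by rewrite expr0; case: (k == 0); rewrite ?normr1// normr0.
have bnd c D j : `|c| <= D -> `|c * mixed_moment a b m j| <= D * (1 + A + B) ^+ m.
  by move=> cD; rewrite normrM ler_pM.
rewrite exprS !mulrDl mul1r (le_trans (ler_normD _ _))// lerD//.
  by rewrite (le_trans (ler_normD _ _))// lerD// bnd.
by case: k => [|k]; [rewrite normr0 mulr_ge0// exprn_ge0// ltW|exact: bnd].
Qed.

Section polynomial_means.
Context {R : realType} (mu : probability (measurableTypeR R) R).

Definition poly_integrable (p : {poly R}) : Prop :=
  mu.-integrable [set: R] (fun y => (p.[y])%:E).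

Definition poly_mean (p : {poly R}) : R := \int[mu]_y p.[y].

Lemma poly_integrableD p r :
  poly_integrable p -> poly_integrable r -> poly_integrable (p + r).
Proof.
move=> ip ir; apply: eq_integrable (integrableD _ ip ir) => //= y _.
by rewrite hornerD EFinD.
Qed.

Lemma poly_integrableZ c p : poly_integrable p -> poly_integrable (c *: p).
Proof.
move=> ip; apply: eq_integrable (integrableZl _ c ip) => //= y _.
by rewrite hornerZ EFinM.
Qed.

Lemma poly_integrable1 : poly_integrable 1.
Proof.
apply: eq_integrable (finite_measure_integrable_cst mu 1 measurableT) => //= y _.
by rewrite hornerC.
Qed.

Lemma poly_meanD p r : poly_integrable p -> poly_integrable r ->
  poly_mean (p + r) = poly_mean p + poly_mean r.
Proof.
move=> ip ir; rewrite /poly_mean -RintegralD//.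
by apply: eq_Rintegral => y _; rewrite hornerD.
Qed.

Lemma poly_meanZ c p : poly_integrable p ->
  poly_mean (c *: p) = c * poly_mean p.
Proof.
move=> ip; rewrite /poly_mean -RintegralZl//.
by apply: eq_Rintegral => y _; rewrite hornerZ.
Qed.

Lemma poly_mean1 : poly_mean 1 = 1.
Proof.
rewrite /poly_mean; under eq_Rintegral do rewrite hornerC.
rewrite Rintegral_cst// mul1r.
exact: (congr1 fine (probability_setT mu)).
Qed.

Lemma poly_integrable_monomials :
  (forall n, poly_integrable 'X^n) -> forall p, poly_integrable p.
Proof.
move=> iX p; rewrite -(coefK p) poly_def.
elim/big_ind: _ => [|p1 p2|i _]; last exact: poly_integrableZ.
- by rewrite -(scale0r 1); apply: poly_integrableZ; exact: poly_integrable1.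
- exact: poly_integrableD.
Qed.

End polynomial_means.

Lemma poly_mean_monomials {R : realType}
    (mu nu : probability (measurableTypeR R) R) :
  (forall p, poly_integrable mu p) -> (forall p, poly_integrable nu p) ->
  (forall n, poly_mean mu 'X^n = poly_mean nu 'X^n) ->
  forall p, poly_mean mu p = poly_mean nu p.
Proof.
move=> imu inu eqX p; rewrite -(coefK p) poly_def.
elim/big_ind: _ => [|p1 p2 e1 e2|i _]; last by rewrite !poly_meanZ// eqX.
- by rewrite -(scale0r 1) !poly_meanZ// !mul0r.
- by rewrite !poly_meanD// e1 e2.
Qed.

Section orthogonality.
Context {R : realType} (a b : nat -> R).
Variable mu : probability (measurableTypeR R) R.
Local Notation p := (monic_ops a b).
Hypothesis mu_orth : orthogonality_measure p mu.

Lemma monic_opsX k :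
  'X * p k = p k.+1 + a k *: p k + (if k is k1.+1 then b k *: p k1 else 0).
Proof.
by case: k => [|k]; rewrite /= -!mul_polyC; ring.
Qed.

(** Orthogonality to p_0 = 1 gives the integrability of each p_k; each
    multiplication by y is then a linear combination of three integrable
    functions of the previous level. *)
Lemma Xn_monic_ops_integrable m k : poly_integrable mu ('X^m * p k).
Proof.
elim: m k => [k|m IH k].
  rewrite mul1r; case: k => [|k]; first exact: poly_integrable1.
  have [ip _] := mu_orth k.+1 0 isT.
  by apply: eq_integrable ip => //= y _; rewrite hornerC mulr1.
rewrite exprSr -mulrA monic_opsX 2!mulrDr -scalerAr.
apply: poly_integrableD.
  by apply: poly_integrableD => //; exact: poly_integrableZ.
case: k => [|k]; last by rewrite -scalerAr; exact: poly_integrableZ.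
by rewrite mulr0 -(scale0r 1); apply: poly_integrableZ; exact: poly_integrable1.
Qed.

Lemma orthogonality_integrable r : poly_integrable mu r.
Proof.
apply: poly_integrable_monomials => n.
by have := Xn_monic_ops_integrable n 0; rewrite mulr1.
Qed.

Lemma poly_mean_orth n m : n != m -> poly_mean mu (p n * p m) = 0.
Proof.
move=> nm; have [_ /(congr1 fine)/=] := mu_orth n m nm.
by rewrite /poly_mean; under eq_Rintegral do rewrite hornerM.
Qed.

(** This is where orthogonality pins down the moments: at k = 0 the right-hand
    side is the m-th moment. *)
Lemma poly_mean_mixed m k :
  poly_mean mu ('X^m * p k) = mixed_moment a b m k.
Proof.
have I := orthogonality_integrable.
elim: m k => [k|m IH k].
  rewrite mul1r; case: k => [|k]; first exact: poly_mean1.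
  by have := poly_mean_orth k.+1 0 isT; rewrite mulr1.
rewrite exprSr -mulrA monic_opsX 2!mulrDr -scalerAr !poly_meanD// poly_meanZ//.
rewrite !IH /=; congr (_ + _); case: k => [|k].
  by rewrite mulr0 -(scale0r 1) poly_meanZ// mul0r.
by rewrite -scalerAr poly_meanZ// IH.
Qed.

(** Both E[p_(n+1)^2] and b_(n+1) E[p_n^2] are equal to E[y p_(n+1) p_n]:
    expand the product y p_n for the first and the product y p_(n+1) for the
    second, and drop the orthogonal terms. *)
Lemma poly_mean_sqr n :
  poly_mean mu (p n * p n) = \prod_(1 <= k < n.+1) b k.
Proof.
have I := orthogonality_integrable.
elim: n => [|n IH]; first by rewrite big_geq// mulr1 poly_mean1.
rewrite big_nat_recr//= -IH.
have -> : p n.+1 * p n.+1 = 'X * p n.+1 * p n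
    + (- a n) *: (p n.+1 * p n)
    + (- (if n is n1.+1 then b n else 0)) *: (p n.+1 * p n.-1).
  rewrite ['X * _ * _]mulrAC monic_opsX; case: n {IH} => [|n];
  by rewrite /= -!mul_polyC !polyCN; ring.
have gt1 : n.+1 != n by rewrite gtn_eqF.
have gt2 : n.+1 != n.-1 by rewrite gtn_eqF// ltnS leq_pred.
have gt3 : n.+2 != n by rewrite gtn_eqF// ltnS leqnSn.
rewrite !poly_meanD// !poly_meanZ// (poly_mean_orth _ _ gt1).
rewrite (poly_mean_orth _ _ gt2) !mulr0 !addr0 monic_opsX 2!mulrDl.
rewrite !poly_meanD// -!scalerAl !poly_meanZ// (poly_mean_orth _ _ gt1).
by rewrite (poly_mean_orth _ _ gt3) mulr0 !add0r mulrC.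
Qed.

Lemma orthogonality_prod_ge0 n : 0 <= \prod_(1 <= k < n.+1) b k.
Proof.
rewrite -poly_mean_sqr; apply: Rintegral_ge0 => y _.
by rewrite hornerM -expr2 sqr_ge0.
Qed.

End orthogonality.

(** * Polynomial approximation of half-lines *)

Section step_polynomials.
Context {R : realType}.

Lemma bernoulli_ineq (a : R) n : -1 <= a -> 1 + n%:R * a <= (1 + a) ^+ n.
Proof.
move=> a1; elim: n => [|n IH]; first by rewrite mul0r addr0 expr0.
have a0 : 0 <= 1 + a by lra.
have n0 : 0 <= n%:R * a ^+ 2 by rewrite mulr_ge0// sqr_ge0.
rewrite exprS (le_trans _ (ler_wpM2l a0 IH))// -[n.+1]addn1 natrD.
by rewrite -subr_ge0 (_ : _ - _ = n%:R * a ^+ 2)//; ring.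
Qed.

(** Bernoulli's inequality for (1+a)^n, combined with (1-a)(1+a) <= 1. *)
Lemma bernoulli_inv_ineq (a : R) n : 0 <= a <= 1 ->
  (1 - a) ^+ n * (1 + n%:R * a) <= 1.
Proof.
move=> /andP[a0 a1].
have Na : 0 <= (1 - a) ^+ n by rewrite exprn_ge0// subr_ge0.
rewrite (le_trans (ler_wpM2l Na (bernoulli_ineq a n _)))//; first by lra.
rewrite -exprMn exprn_ile1//; first by rewrite mulr_ge0; lra.
by rewrite -subr_sqr expr1n gerBl sqr_ge0.
Qed.

(** With z = 1/2 + cy between 0 and 1, the power (1 - z^n)^(2^n) tends to 1 for
    z < 1/2 and to 0 for z > 1/2, but to 1/e at z = 1/2.  On this range the second
    factor tends to 1 away from cy = 0 and vanishes at cy = 0 for n > 0, which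
    repairs the value there. *)
Definition step_poly (c : R) (n : nat) : {poly R} :=
  (1 - (2^-1%:P + c *: 'X) ^+ n) ^+ (2 ^ n) * (1 - (1 - (c *: 'X) ^+ 2) ^+ n).

Lemma step_polyE c n y : (step_poly c n).[y] =
  (1 - (2^-1 + c * y) ^+ n) ^+ (2 ^ n) * (1 - (1 - (c * y) ^+ 2) ^+ n).
Proof. by rewrite /step_poly !(hornerE, horner_exp). Qed.

Lemma step_poly_bound c n y : `|c * y| < 2^-1 ->
  0 <= (step_poly c n).[y] <= 1.
Proof.
rewrite step_polyE; set w := c * y; rewrite ltr_norml => /andP[w1 w2].
have z01 : 0 <= 2^-1 + w <= 1 by apply/andP; split; lra.
have w01 : 0 <= 1 - w ^+ 2 <= 1 by apply/andP; split; nra.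
have unit (z : R) k : 0 <= z <= 1 -> 0 <= 1 - z ^+ k <= 1.
  move=> /andP[z0 z1]; have := exprn_ge0 k z0; have := exprn_ile1 k z0 z1.
  by move=> *; apply/andP; split; lra.
have /andP[u0 u1] := unit _ n z01; have /andP[v0 v1] := unit _ n w01.
by rewrite mulr_ge0 ?exprn_ge0//= mulr_ile1// ?exprn_ge0// exprn_ile1.
Qed.

Lemma cvg_one_subX (z : R) : `|z| < 1 ->
  (1 - z ^+ n @[n --> \oo] --> (1 : R))%classic.
Proof.
by move=> /cvg_expr z0; have := cvgB (cvg_cst (1 : R)) z0; rewrite subr0; exact.
Qed.

(** For z < 1/2 Bernoulli gives (1 - z^n)^(2^n) >= 1 - (2z)^n, and for z > 1/2
    its dual form gives (1 - z^n)^(2^n) <= (2z)^(-n). *)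
Lemma step_poly_cvg c y : `|c * y| < 2^-1 ->
  ((step_poly c n).[y] @[n --> \oo] --> ((c * y < 0)%R%:R : R))%classic.
Proof.
under eq_fun do rewrite step_polyE.
set w := c * y; rewrite ltr_norml => /andP[w1 w2].
have z0 : 0 < 2^-1 + w by lra.
have z1 : 2^-1 + w < 1 by lra.
have [w0|w0|w0] := ltgtP w 0.
- have -> : true%:R = 1 * 1 :> R by rewrite mulr1.
  apply: cvgM; last first.
    by apply: cvg_one_subX; rewrite ger0_norm; nra.
  apply: (@squeeze_cvgr _ _ _ _ (fun n => 1 - (2 * (2^-1 + w)) ^+ n) (fun=> 1)).
  + apply: nearW => n /=.
    have zn0 : 0 <= (2^-1 + w) ^+ n by rewrite exprn_ge0// ltW.
    have zn1 : (2^-1 + w) ^+ n <= 1 by rewrite exprn_ile1// ltW.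
    apply/andP; split; last by rewrite exprn_ile1//; lra.
    have := bernoulli_ineq (- (2^-1 + w) ^+ n) (2 ^ n).
    by rewrite mulrN exprMn natrX; apply; lra.
  + by apply: cvg_one_subX; rewrite ger0_norm; lra.
  + exact: cvg_cst.
- apply: (@squeeze_cvgr _ _ _ _ (fun=> 0) (fun n => (2 * (2^-1 + w))^-1 ^+ n)).
  + apply: nearW => n.
    have zn0 : 0 < (2^-1 + w) ^+ n by rewrite exprn_gt0.
    have zn1 : (2^-1 + w) ^+ n <= 1 by rewrite exprn_ile1// ltW.
    have zn01 : 0 <= (2^-1 + w) ^+ n <= 1 by rewrite zn1 ltW.
    have u0 : 0 <= (1 - (2^-1 + w) ^+ n) ^+ (2 ^ n).
      by rewrite exprn_ge0//; lra.
    have v0 : 0 <= (1 - w ^+ 2) ^+ n by rewrite exprn_ge0//; nra.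
    have v1 : (1 - w ^+ 2) ^+ n <= 1 by rewrite exprn_ile1//; nra.
    have := bernoulli_inv_ineq _ (2 ^ n) zn01.
    rewrite natrX -exprMn exprVn; set T := (2 * _) ^+ n.
    have T0 : 0 < T by rewrite exprn_gt0//; lra.
    move: u0; set U := (1 - _) ^+ (2 ^ n) => u0 UT.
    apply/andP; split; first by rewrite mulr_ge0//; lra.
    apply: (@le_trans _ _ U); first by rewrite ler_piMr//; lra.
    by rewrite -[T^-1]mul1r ler_pdivlMr//; nra.
  + exact: cvg_cst.
  + apply: cvg_expr; rewrite ger0_norm ?invr_ge0; last lra.
    by rewrite invf_lt1; lra.
- apply: cvg_near_cst; apply: nearW => n /=.
  by rewrite w0 expr0n/= subr0 expr1n subrr mulr0.
Qed.

End step_polynomials.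

(** * Determinacy *)

Section determinacy.
Context {R : realType}.
Implicit Types mu nu : probability (measurableTypeR R) R.

(** Markov's inequality for y^(2n): the mass of the complement times (2C)^(2n)
    is at most C^(2n) for every n. *)
Lemma moment_bound_support mu (C : R) : 0 < C ->
  (forall p, poly_integrable mu p) ->
  (forall n, `|poly_mean mu 'X^n| <= C ^+ n) ->
  mu (~` `]- (2 * C), 2 * C[)%classic = 0%E.
Proof.
move=> C0 I bnd; set S := (~` _)%classic.
have mS : measurable S by apply: measurableC; exact: measurable_itv.
have fS : mu S \is a fin_num by exact: fin_num_measure.
have mS0 : (0 <= mu S)%E by exact: measure_ge0.
have key n : fine (mu S) * 4 ^+ n <= 1.
  have intS : mu.-integrable [set: R] (EFin \o (fun y => (2 * C) ^+ (2 * n) * \1_S y)).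
    apply: eq_integrable (integrableZl _ ((2 * C) ^+ (2 * n))
      (integrable_indic mu mS)) => //.
  have : \int[mu]_y ((2 * C) ^+ (2 * n) * \1_S y) <= poly_mean mu 'X^(2 * n).
    apply: le_Rintegral => //; first exact: (I 'X^(2 * n)).
    move=> y _; rewrite hornerXn !exprM.
    have [yS|yS] := boolP (y \in S); last first.
      by rewrite indicE (negbTE yS) mulr0 exprn_ge0// sqr_ge0.
    rewrite indicE yS mulr1 lerXn2r ?nnegrE ?sqr_ge0//.
    move: yS; rewrite inE /S /= in_itv/= => /negP.
    rewrite negb_and -!leNgt => /orP[]; nra.
  rewrite RintegralZl//; last exact: integrable_indic.
  rewrite /Rintegral integral_indic// setIT => le1.
  have le2 := le_trans le1 (le_trans (ler_norm _) (bnd _)).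
  have C2 : 0 < C ^+ (2 * n) by rewrite exprn_gt0.
  rewrite -(ler_pM2l C2) mulr1 (le_trans _ le2)// exprMn [2 ^+ _]exprM.
  rewrite (_ : 2 ^+ 2 = 4)//; first by rewrite [_ * C ^+ _]mulrC -mulrA [4 ^+ n * _]mulrC.
  by rewrite -natrX.
(* A positive mass m would contradict 1 + 3n <= 4^n for n > 1/m. *)
apply/eqP; rewrite eq_le mS0 andbT -(fineK fS) lee_fin leNgt; apply/negP => m0.
set m := fine _ in key m0; have := archi_boundP (ltW (_ : 0 < m^-1)).
rewrite invr_gt0 => /(_ m0); set n := Num.bound _ => nm.
have nT : 1 + n%:R * 3 <= 4 ^+ n :> R.
  by have -> : 4 = 1 + 3 :> R; [ring|apply: bernoulli_ineq; lra].
have := key n; move: nT; set T := 4 ^+ n => nT mT.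
have m1 : 1 < n%:R * m by rewrite -ltr_pdivrMr// div1r.
have n0 : 0 <= n%:R :> R by [].
nra.
Qed.

(** Dominated convergence.  The scaling factor is chosen so that y - u, for
    |y| < r, falls in the range where the step polynomials have values between
    0 and 1. *)
Lemma step_poly_mean_cvg mu (r u : R) : 0 < r ->
  (forall p, poly_integrable mu p) -> mu (~` `]- r, r[)%classic = 0%E ->
  let P n := step_poly (2 * (r + `|u|))^-1 n \Po ('X - u%:P) in
  ((poly_mean mu (P n))%:E @[n --> \oo] --> mu `]-oo, u[)%classic.
Proof.
move=> r0 I S0; set c := (2 * _)^-1 => P.
have mS : measurable (~` `]- r, r[)%classic.
  by apply: measurableC; exact: measurable_itv.
have PE n y : (P n).[y] = (step_poly c n).[y - u].
  by rewrite /P horner_comp hornerXsubC.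
have L0 : 0 < r + `|u| by rewrite ltr_pwDl.
have c0 : 0 < c by rewrite invr_gt0 mulr_gt0.
have small y : `]- r, r[%classic y -> `|c * (y - u)| < 2^-1.
  rewrite /= in_itv/= -ltr_norml => yr.
  rewrite normrM gtr0_norm// /c invfM -mulrA -[X in _ < X]mulr1 ltr_pM2l//.
  rewrite mulrC ltr_pdivrMr// mul1r (le_lt_trans (ler_normB _ _))//.
  by rewrite ltrD2r.
have aeS (Q : R -> Prop) : (forall y, `]- r, r[%classic y -> Q y) ->
    {ae mu, forall y, Q y}.
  move=> HQ; exists (~` `]- r, r[)%classic; split => //.
  by move=> y /= nQ yr; apply: nQ; exact: HQ.
have mU : measurable (`]-oo, u[%classic : set R) by exact: measurable_itv.
have [] := @dominated_convergence _ _ R mu setT measurableT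
  (fun n y => ((P n).[y])%:E) (fun y => (\1_(`]-oo, u[%classic : set R) y)%:E)
  (EFin \o cst 1).
- by move=> n; exact: measurable_int (I (P n)).
- by apply/measurable_EFinP; exact: measurable_indic.
- apply: aeS => y /small ys _; apply: cvg_EFin; first by apply: nearW.
  rewrite (_ : \1__ y = (c * (y - u) < 0)%R%:R).
    by under eq_fun do rewrite /= PE; exact: step_poly_cvg.
  by rewrite indicE mem_setE in_itv/= pmulr_rlt0// subr_lt0.
- exact: finite_measure_integrable_cst.
- apply: aeS => y /small ys n _; rewrite /= lee_fin PE.
  by have /andP[p0 p1] := step_poly_bound _ n _ ys; rewrite ger0_norm.
move=> _ _; rewrite integral_indic// setIT; apply: cvg_trans.
apply: near_eq_cvg; apply: nearW => n.
by rewrite /poly_mean /Rintegral fineK//; apply: integrable_fin_num => //; exact: I.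
Qed.

Lemma eq_probability_half_lines mu nu :
  (forall u, mu `]-oo, u[%classic = nu `]-oo, u[%classic) ->
  forall A, measurable A -> mu A = nu A.
Proof.
move=> eqU A mA.
apply: (@measure_unique _ R (measurableTypeR R) (@RGenInftyO.G R)
  (fun n => `]-oo, n%:R[%classic) _ _ _ _ mu nu) => //.
- exact: RGenInftyO.measurableE.
- move=> _ _ [x ->] [y ->]; exists (Num.min x y).
  by apply/seteqP; split => z /=; rewrite !in_itv/= lt_min => /andP.
- by move=> n; exists n%:R.
- apply/seteqP; split => // y _; exists (Num.bound `|y|) => //=.
  by rewrite in_itv/= (le_lt_trans (ler_norm y))// archi_boundP.
- by move=> _ [x ->]; exact: eqU.
- by move=> n; rewrite -ge0_fin_numE ?measure_ge0//; exact: fin_num_measure.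
Qed.

(** The moment problem is determinate under geometric growth of the moments:
    the mass of a half-line is the limit of the means of polynomials that do not
    depend on the measure. *)
Lemma moment_determinate mu nu (C : R) : 0 < C ->
  (forall p, poly_integrable mu p) -> (forall p, poly_integrable nu p) ->
  (forall n, `|poly_mean mu 'X^n| <= C ^+ n) ->
  (forall n, poly_mean mu 'X^n = poly_mean nu 'X^n) ->
  forall A, measurable A -> mu A = nu A.
Proof.
move=> C0 Imu Inu bnd eqX; apply: eq_probability_half_lines => u.
have C20 : 0 < 2 * C by lra.
have Smu := moment_bound_support mu C C0 Imu bnd.
have Snu : nu (~` `]- (2 * C), 2 * C[)%classic = 0%E.
  by apply: moment_bound_support => // n; rewrite -eqX.
have := step_poly_mean_cvg mu (2 * C) u C20 Imu Smu.
have := step_poly_mean_cvg nu (2 * C) u C20 Inu Snu.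
rewrite /=; under eq_fun do rewrite -(poly_mean_monomials mu nu Imu Inu eqX).
by move=> cnu cmu; exact: (cvg_unique _ cmu cnu).
Qed.

End determinacy.

Lemma orthogonality_measure_unique {R : realType} (a b : nat -> R)
    (mu nu : probability (measurableTypeR R) R) :
  (exists M, forall n, `|a n| <= M) -> (exists M, forall n, `|b n| <= M) ->
  orthogonality_measure (monic_ops a b) mu ->
  orthogonality_measure (monic_ops a b) nu ->
  forall A, measurable A -> mu A = nu A.
Proof.
move=> ba bb omu onu.
have [C C0 HC] := mixed_moment_bounded a b ba bb.
have mX (k : probability (measurableTypeR R) R) n :
    orthogonality_measure (monic_ops a b) k ->
    poly_mean k 'X^n = mixed_moment a b n 0.
  by move=> ok; rewrite -(poly_mean_mixed _ _ _ ok) mulr1.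
apply: (moment_determinate mu nu C C0).
- exact: orthogonality_integrable omu.
- exact: orthogonality_integrable onu.
- by move=> n; rewrite mX.
- by move=> n; rewrite !mX.
Qed.

(** * Identification of the two laws *)

Theorem theorem5p2 (R : realType) (eta theta tau q : R)
    (tau_ge0 : 0 <= tau) (q_lt1 : `|q| < 1)
    (thetat : R) (thetatE : thetat = theta + eta * tau / (1 - q))
    (existence : Num.max 0 q <= 1 + eta * thetat)
    (t : R) (t_gt0 : 0 < t) (x : R) :
  let is_Q := bi_poisson_transition eta thetat q
    (q ^+ 2 * alpha_ tau q t / (1 - q)) (alpha_ tau q t / (1 - q))
    (q * x + gamma_ eta theta t + beta_ eta tau q t) in
  ((exists mu, is_nu x t eta theta tau q mu) <-> (exists mu, is_Q mu)) /\
  (forall mu mu' : probability (measurableTypeR R) R,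
     is_nu x t eta theta tau q mu -> is_Q mu' ->
     forall A : set (measurableTypeR R), measurable A -> mu A = mu' A).
Proof.
move=> is_Q.
have q1 : 0 < 1 - q by move: q_lt1; rewrite ltr_norml => /andP[]; lra.
have q_neq1 : q != 1 by rewrite lt_eqF// -subr_gt0.
have QE : Q_poly eta thetat q (q ^+ 2 * alpha_ tau q t / (1 - q))
    (alpha_ tau q t / (1 - q)) (q * x + gamma_ eta theta t + beta_ eta tau q t)
    = B_poly x t eta theta tau q.
  apply: eq_monic_ops => n; first exact: Q_diagE.
  exact: Q_subE.
have QP mu : is_Q mu <-> is_nu x t eta theta tau q mu.
  split=> [[_ _]|omu]; first by rewrite QE.
  split; last by rewrite QE.
    have al0 : 0 < alpha_ tau q t by rewrite ltr_wpDl// mulr_gt0.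
    have s0 : 0 <= q ^+ 2 * alpha_ tau q t by rewrite mulr_ge0 ?sqr_ge0// ltW.
    rewrite (divr_ge0 s0 (ltW q1)) /= ltr_pM2r ?invr_gt0// gtr_pMl//.
    by rewrite -real_normK ?num_real// exprn_ilt1.
  move=> n _; rewrite (eq_bigr (B_sub x t eta theta tau q)) => [|k _].
    exact: orthogonality_prod_ge0 omu n.
  exact: Q_subE.
split; first by split=> -[mu /QP]; exists mu.
move=> mu mu' omu /QP; apply: orthogonality_measure_unique omu.
  exact: B_diag_bounded.
exact: B_sub_bounded.
Qed.
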